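(* For every positive integer $n$, $$\sum_{k=0}^{n}\binom{n}{k}F_{n-k}(y,t)F_k(y,t)=\frac{1}{y^2+4t}\left(2^nL_n(y,t)-2y^n\right),$$ $$\sum_{k=0}^{n}\binom{n}{k}L_{n-k}(y,t)L_k(y,t)=2^nL_n(y,t)+2y^n,$$ $$\sum_{k=0}^{n}\binom{n}{k}F_{n-k}(y,t)L_k(y,t)=2^nF_n(y,t).$$
   Context: Here $y,t$ are commuting variables (indeterminates). The bivariate Fibonacci polynomials are defined by $F_0(y,t)=0$, $F_1(y,t)=1$, $F_n(y,t)=yF_{n-1}(y,t)+tF_{n-2}(y,t)$ for $n\ge 2$; the bivariate Lucas polynomials by $L_0(y,t)=2$, $L_1(y,t)=y$, $L_n(y,t)=yL_{n-1}(y,t)+tL_{n-2}(y,t)$ for $n\ge 2$. *)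

(* Defs.v *)
From mathcomp Require Export all_boot all_algebra.
From mathcomp Require Export mpoly.

Set Implicit Arguments.
Unset Strict Implicit.
Unset Printing Implicit Defensive.

Import GRing.Theory.
Local Open Scope ring_scope.

(* R[y, t] is {mpoly R[2]}.  The coefficient ring R is an arbitrary integral
   domain, so that R[y, t] embeds in its fraction field R(y, t).              *)
Section BivariateFibonacciLucas.
Variable R : idomainType.

Definition vy : {mpoly R[2]} := 'X_(inord 0).
Definition vt : {mpoly R[2]} := 'X_(inord 1).

Fixpoint Fib (n : nat) : {mpoly R[2]} :=
  match n with
  | 0 => 0
  | 1 => 1
  | (m.+1 as p).+1 => vy * Fib p + vt * Fib m
  end.

Fixpoint Luc (n : nat) : {mpoly R[2]} :=
  match n with
  | 0 => 2%:R
  | 1 => vy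
  | (m.+1 as p).+1 => vy * Luc p + vt * Luc m
  end.

End BivariateFibonacciLucas.

Arguments vy {R}.
Arguments vt {R}.
Arguments Fib {R} n.
Arguments Luc {R} n.

(* Main.v *)
(** Binomial convolution obeys the Leibniz rule
    S(n+1; U, V) = S(n; EU, V) + S(n; U, EV) for the shift E.  For U, V with
    E^2 = yE + t, the sums S(U, V), S(EU, V) + S(U, EV), S(EU, EV) therefore
    form a closed linear system in n.  With a + b = y and ab = -t, the terms
    a^n and b^n convolve to (2a)^n and (2b)^n with themselves and to y^n with
    each other, so the solution has the form 2^n W_n + c y^n. *)
Require Import Defs.
From mathcomp Require Import all_boot all_algebra mpoly ring.

Set Implicit Arguments.
Unset Strict Implicit.
Unset Printing Implicit Defensive.

Import GRing.Theory.
Local Open Scope ring_scope.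

Section BinomialConvolution.
Variable A : comNzRingType.
Implicit Types U V W : nat -> A.

Definition binconv U V (n : nat) : A :=
  \sum_(0 <= k < n.+1) 'C(n, k)%:R * U (n - k)%N * V k.

Definition shift U (n : nat) : A := U n.+1.

Definition linrec2 (y t : A) U := forall n, U n.+2 = y * U n.+1 + t * U n.

Lemma binconv0 U V : binconv U V 0 = U 0 * V 0.
Proof. by rewrite /binconv big_nat1 bin0 mul1r. Qed.

(** Pascal's rule splits each coefficient of the left side after its first term; the two halves are
    the sums on the right. *)
Lemma binconvS U V n :
  binconv U V n.+1 = binconv (shift U) V n + binconv U (shift V) n.
Proof.
rewrite /binconv /shift big_nat_recl // [in X in _ = X + _]big_nat_recl //.
rewrite !bin0 !subn0 -addrA; congr (_ + _).
under eq_big_nat => k _ do rewrite binS natrD subSS !mulrDl.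
rewrite big_split /=; congr (_ + _).
(* The top term carries ['C(n, n.+1)], which is 0. *)
rewrite big_nat_recr //= bin_small // !mul0r addr0.
by apply: eq_big_nat => k /andP[_ lt_kn]; rewrite -subSn.
Qed.

Lemma binconv_recl y t U V n : linrec2 y t U ->
  binconv (shift (shift U)) V n = y * binconv (shift U) V n + t * binconv U V n.
Proof.
move=> recU; rewrite /binconv !mulr_sumr -big_split.
by apply: eq_bigr => k _; rewrite /shift recU /=; ring.
Qed.

Lemma binconv_recr y t U V n : linrec2 y t V ->
  binconv U (shift (shift V)) n = y * binconv U (shift V) n + t * binconv U V n.
Proof.
move=> recV; rewrite /binconv !mulr_sumr -big_split.
by apply: eq_bigr => k _; rewrite /shift recV /=; ring.
Qed.

(** The factor [d] clears the denominator. The three initial conditions are the case n = 0 of the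
    system proved by induction. *)
Lemma binconv_closed_form y t U V W d c :
    linrec2 y t U -> linrec2 y t V -> linrec2 y t W ->
    d * (U 0 * V 0) = W 0 + c ->
    d * (U 1 * V 0 + U 0 * V 1) = 2%:R * W 1 + c * y ->
    d * (U 1 * V 1) = W 2 - c * t ->
  forall n, d * binconv U V n = 2%:R ^+ n * W n + c * y ^+ n.
Proof.
move=> recU recV recW init0 init1 init2 n.
(* The cross terms acquire the factor a + b = y in the second identity and ab = -t in the third. *)
suff [] : [/\ d * binconv U V n = 2%:R ^+ n * W n + c * y ^+ n,
    d * (binconv (shift U) V n + binconv U (shift V) n)
      = 2%:R ^+ n.+1 * W n.+1 + c * y ^+ n.+1
  & d * binconv (shift U) (shift V) n
      = 2%:R ^+ n * W n.+2 - c * t * y ^+ n] by [].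
elim: n => [|n [IH0 IH1 IH2]].
  by rewrite !binconv0 !expr0 !expr1 !mul1r !mulr1.
split; first by rewrite binconvS IH1.
- rewrite !binconvS (binconv_recl _ _ recU) (binconv_recr _ _ recV).
  set P := binconv (shift U) V n in IH1 *; set Q := binconv U (shift V) n in IH1 *.
  set X := binconv U V n in IH0 *; set Z := binconv _ _ n in IH2 *.
  transitivity (y * (d * (P + Q)) + 2%:R * t * (d * X) + 2%:R * (d * Z)).
    by ring.
  by rewrite IH0 IH1 IH2 recW !exprS; ring.
- rewrite binconvS (binconv_recl _ _ recU) (binconv_recr _ _ recV).
  set P := binconv (shift U) V n in IH1 *; set Q := binconv U (shift V) n in IH1 *.
  set Z := binconv _ _ n in IH2 *.
  transitivity (2%:R * y * (d * Z) + t * (d * (P + Q))); first by ring.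
  by rewrite IH1 IH2 (recW n.+1) !exprS; ring.
Qed.

End BinomialConvolution.

(** At y = 1, t = 0 the value is 1, in every characteristic. *)
Lemma discriminant_neq0 (R : idomainType) :
  vy ^+ 2 + 4%:R * vt != 0 :> {mpoly R[2]}.
Proof.
pose v (i : 'I_2) : R := (i == inord 0)%:R.
apply/eqP => /(congr1 (meval v)).
rewrite expr2 mevalD !mevalM !mevalXU meval0 /v eqxx -val_eqE /= !inordK //.
by rewrite mulr0 addr0 mulr1 => /eqP; rewrite oner_eq0.
Qed.

Theorem corollary1 (R : idomainType) (n : nat) (n_gt0 : (0 < n)%N) :
  [/\ tofrac (\sum_(0 <= k < n.+1) 'C(n, k)%:R * Fib (n - k) * Fib k
                : {mpoly R[2]})
        = 1 / tofrac (vy ^+ 2 + 4%:R * vt)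
            * tofrac (2%:R ^+ n * Luc n - 2%:R * vy ^+ n),
      \sum_(0 <= k < n.+1) 'C(n, k)%:R * Luc (n - k) * Luc k
        = 2%:R ^+ n * Luc n + 2%:R * vy ^+ n :> {mpoly R[2]}
    & \sum_(0 <= k < n.+1) 'C(n, k)%:R * Fib (n - k) * Luc k
        = 2%:R ^+ n * Fib n :> {mpoly R[2]}].
Proof.
have recF : linrec2 vy vt (@Fib R) by [].
have recL : linrec2 vy vt (@Luc R) by [].
split.
(* Here d = (a - b)^2 = y^2 + 4t and c = -2. *)
- have <- : (vy ^+ 2 + 4%:R * vt) * binconv (@Fib R) (@Fib R) n
            = 2%:R ^+ n * Luc n - 2%:R * vy ^+ n.
    by rewrite -mulNr; apply: (binconv_closed_form recF recF recL) => /=; ring.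
  rewrite tofracM mulrA mul1r mulVf ?mul1r //.
  by rewrite tofrac_eq0 discriminant_neq0.
- rewrite -[LHS]mul1r.
  by apply: (binconv_closed_form recL recL recL) => /=; ring.
(* The cross terms cancel, so c = 0; the goal is padded to match the closed form. *)
- rewrite -[LHS]mul1r -[RHS]addr0 -[X in _ = _ + X](mul0r (vy ^+ n)).
  by apply: (binconv_closed_form recF recL recF) => /=; ring.
Qed.
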